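(* Let $R$ be a commutative ring with unity, $t$ a positive integer, $a\in R$, $I$ the ideal of $R$ generated by $a$, and $M$ an $R$-module. The following statements are equivalent: 1. $M$ is $a^{t}$-reduced; 2. $a^{t}\Gamma_{a}(M)=0$; 3. $(0:_{M}a^{k})=(0:_{M}a^{t})$ for all positive integers $k\geq t$; 4. $\mathrm{Hom}_{R}(R/I^{k},M)\cong \mathrm{Hom}_{R}(R/I^{t},M)$ for all positive integers $k\geq t$; 5. $\Gamma_{a}(M)\cong \mathrm{Hom}_{R}(R/I^{t},M)$; 6. $0\to \Gamma_{a}(M)\to M\to a^{t}M\to 0$ is a short exact sequence, where $\Gamma_{a}(M)\to M$ is the inclusion and $M\to a^{t}M$ is the map $m\mapsto a^{t}m$.
   Context: Isomorphisms are isomorphisms of $R$-modules. For $a\in R$ and an $R$-module $M$, $\Gamma_{a}(M):=\{m\in M \mid a^{k}m=0 \text{ for some } k\in\mathbb{Z}^{+}\}$ and $a^{t}\Gamma_{a}(M):=\{a^{t}m\mid m\in\Gamma_{a}(M)\}$. For $k\in\mathbb{Z}^{+}$, $(0:_{M}a^{k}):=\{m\in M\mid a^{k}m=0\}$. The module $M$ is called $a^{t}$-reduced if for all $m\in M$ and all positive integers $k\geq t$, $a^{k}m=0$ implies $a^{t}m=0$. *)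

(* Defs.v *)
From HB Require Import structures.
From mathcomp Require Import all_boot all_order all_algebra.
From mathcomp Require Import all_classical.

Set Implicit Arguments.
Unset Strict Implicit.
Unset Printing Implicit Defensive.

Import GRing.Theory.
Local Open Scope classical_set_scope.
Local Open Scope ring_scope.

Record submodule (R : pzRingType) (V : lmodType R) := Submodule {
  carrier :> set V;
  carrierP : submod_closed (in_set carrier)
}.

Section SubmoduleTheory.
Variables (R : pzRingType) (V : lmodType R).
Implicit Types (S : submodule V) (A : set V).

Lemma submod_closedP A : A 0 ->
  (forall (c : R) (u v : V), A u -> A v -> A (c *: u + v)) ->
  submod_closed (in_set A).
Proof.
move=> A0 AD; split=> [|c u v]; rewrite -!topredE/= ?inE //; exact: AD.
Qed.

Lemma submod0 S : carrier S 0.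
Proof. by have [+ _] := carrierP S; rewrite -topredE/= inE. Qed.

Lemma submodD S (c : R) u v :
  carrier S u -> carrier S v -> carrier S (c *: u + v).
Proof.
have [_ /(_ c u v)] := carrierP S; rewrite -!topredE/= !inE => H Su Sv.
exact: H.
Qed.

Definition submod_pred S : V -> bool := in_set (carrier S).

Lemma submod_pred_closed S : subsemimod_closed (submod_pred S).
Proof. exact: GRing.submod_closed_semi (carrierP S). Qed.

HB.instance Definition _ S :=
  GRing.isSubmodClosed.Build R V (submod_pred S) (submod_pred_closed S).

(* The elements of S, as an R-module for the operations of V. *)
Definition submod_type S := {x : V | submod_pred S x}.

HB.instance Definition _ S := SubChoice.on (submod_type S).
HB.instance Definition _ S := [SubChoice_isSubLmodule of submod_type S by <:].

Definition submod_incl S : {linear submod_type S -> V} := val.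

Definition in_submod S (x : V) (Sx : carrier S x) : submod_type S :=
  exist _ x (mem_set Sx).

Definition full_submod : submodule V :=
  @Submodule R V setT (submod_closedP I (fun _ _ _ _ _ => I)).

Definition is_submod A := submod_closed (in_set A).

Lemma submod_span_closed A : is_submod (smallest is_submod A).
Proof.
apply: submod_closedP => [B [Bsub _]|c u v Au Av B [Bsub AB]].
  exact: (submod0 (Submodule Bsub)).
by apply: (@submodD (Submodule Bsub)) => /=; [apply: Au|apply: Av].
Qed.

Definition submod_span A : submodule V := Submodule (submod_span_closed A).

Local Notation quot_of S :=
  (Quotient.quot (GRing.ZmodClosed.clone V (submod_pred S) _)).

Definition quotmod S : Type := quot_of S.

HB.instance Definition _ S := GRing.Zmodule.on (quotmod S).

Definition quotmod_pi S (x : V) : quotmod S := \pi_(quot_of S)%qT x.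

Definition quotmod_scale S (c : R) (x : quotmod S) : quotmod S :=
  quotmod_pi S (c *: (repr (x : quot_of S))%qT).

Lemma quotmod_piE S x y :
  quotmod_pi S x = quotmod_pi S y <-> x - y \in submod_pred S.
Proof.
by rewrite Quotient.idealrBE; split=> [/eqP//|/eqP].
Qed.

Lemma quotmod_scaleE S c x :
  quotmod_scale c (quotmod_pi S x) = quotmod_pi S (c *: x).
Proof.
apply/quotmod_piE; rewrite -scalerBr rpredZ //.
by apply/quotmod_piE; rewrite /quotmod_pi reprK.
Qed.

Lemma quotmod_reprK S (x : quotmod S) : exists y, x = quotmod_pi S y.
Proof. by exists (repr (x : quot_of S))%qT; rewrite /quotmod_pi reprK. Qed.

Lemma quotmod_piD S x y :
  quotmod_pi S (x + y) = quotmod_pi S x + quotmod_pi S y.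
Proof. exact: raddfD. Qed.

Fact quotmod_scaleA S c d (x : quotmod S) :
  quotmod_scale c (quotmod_scale d x) = quotmod_scale (c * d) x.
Proof. by have [y ->] := quotmod_reprK x; rewrite !quotmod_scaleE scalerA. Qed.

Fact quotmod_scale1 S : left_id 1 (@quotmod_scale S).
Proof.
by move=> x; have [y ->] := quotmod_reprK x; rewrite quotmod_scaleE scale1r.
Qed.

Fact quotmod_scaleDr S : right_distributive (@quotmod_scale S) +%R.
Proof.
move=> c x y; have [u ->] := quotmod_reprK x; have [v ->] := quotmod_reprK y.
by rewrite -quotmod_piD !quotmod_scaleE -quotmod_piD scalerDr.
Qed.

Fact quotmod_scaleDl S (x : quotmod S) :
  {morph (@quotmod_scale S)^~ x : c d / c + d}.
Proof.
move=> c d; have [u ->] := quotmod_reprK x.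
by rewrite !quotmod_scaleE -quotmod_piD scalerDl.
Qed.

HB.instance Definition _ S := GRing.Zmodule_isLmodule.Build R (quotmod S)
  (@quotmod_scaleA S) (@quotmod_scale1 S) (@quotmod_scaleDr S)
  (@quotmod_scaleDl S).

End SubmoduleTheory.

Section ModuleRelations.
Variable R : pzRingType.

Definition lmod_iso (U V : lmodType R) : Prop :=
  exists f : {linear U -> V}, bijective f.

(* Exactness of 0 -> A -> B -> C -> 0 at A, at B and at C. *)
Definition short_exact (A B C : lmodType R)
    (f : {linear A -> B}) (g : {linear B -> C}) : Prop :=
  [/\ f @^-1` [set 0] = [set 0],
      range f = g @^-1` [set 0] &
      range g = [set: C]].

End ModuleRelations.

Section CommutativeRing.
Variable R : comPzRingType.

Lemma HomR_closed (U V : lmodType R) :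
  submod_closed (in_set [set f : U -> V | linear f]).
Proof.
apply: submod_closedP => /= [c u v|c f g lf lg d u v].
  by rewrite /GRing.zero/= scaler0 addr0.
have E h w : (c *: f + h) w = c *: f w + h w by [].
rewrite !E lf lg !scalerDr !scalerA (mulrC c d) -!addrA; congr (_ + _).
by rewrite addrCA.
Qed.

(* The submodule of U -> V is needed because {linear U -> V} carries no
   R-module structure in the library. *)
Definition HomR (U V : lmodType R) :=
  submod_type (Submodule (HomR_closed U V)).

HB.instance Definition _ (U V : lmodType R) := GRing.Lmodule.on (HomR U V).

(* Ideals of R are the submodules of R regarded as a module over itself. *)
Definition ideal := submodule R^o.

Definition ideal_mul (I J : ideal) : ideal :=
  @submod_span R R^o [set (x : R) * (y : R) | x in I & y in J].

Definition ideal_exp (I : ideal) (k : nat) : ideal :=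
  iter k (ideal_mul I) (full_submod R^o).

Variables (a : R) (M : lmodType R).

Definition Gamma_set : set M :=
  [set m | exists2 k, (0 < k)%N & a ^+ k *: m = 0].

Lemma Gamma_closed : submod_closed (in_set Gamma_set).
Proof.
apply: submod_closedP => [|c u v [k k0 ku] [l l0 lv]].
  by exists 1%N; rewrite ?scaler0.
exists (k + l)%N; first by rewrite addn_gt0 k0.
rewrite scalerDr exprD.
have -> : a ^+ k * a ^+ l *: (c *: u) = 0.
  by rewrite mulrC scalerA -mulrA (mulrC _ c) mulrA -scalerA ku scaler0.
by rewrite -scalerA lv scaler0 addr0.
Qed.

Definition Gamma : submodule M := Submodule Gamma_closed.

Definition colon0 (k : nat) : set M := [set m | a ^+ k *: m = 0].

Definition reduced (t : nat) : Prop :=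
  forall (m : M) (k : nat), (0 < k)%N -> (t <= k)%N ->
    a ^+ k *: m = 0 -> a ^+ t *: m = 0.

Variable t : nat.

Lemma power_image_closed :
  submod_closed (in_set (range (fun m : M => a ^+ t *: m))).
Proof.
apply: submod_closedP => [|c _ _ [u _ <-] [v _ <-]].
  by exists 0; rewrite ?scaler0.
by exists (c *: u + v); rewrite // scalerDr !scalerA mulrC.
Qed.

Definition power_image : submodule M := Submodule power_image_closed.

Definition power_map_fun (m : M) : submod_type power_image :=
  @in_submod R M power_image (a ^+ t *: m) (ex_intro2 _ _ m I erefl).

Fact power_map_is_linear : linear power_map_fun.
Proof.
by move=> c u v; apply: val_inj; rewrite /= scalerDr !scalerA mulrC.
Qed.

HB.instance Definition _ := GRing.isLinear.Build R M
  (submod_type power_image) *:%R power_map_fun power_map_is_linear.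

Definition power_map : {linear M -> submod_type power_image} := power_map_fun.

End CommutativeRing.

Arguments Gamma {R} a M.
Arguments colon0 {R} a M k.
Arguments reduced {R} a M t.
Arguments power_image {R} a M t.
Arguments power_map {R} a M t.

(* Main.v *)
Require Import Defs.
From HB Require Import structures.
From mathcomp Require Import all_boot all_order all_algebra.
From mathcomp Require Import all_classical.

Import GRing.Theory.
Local Open Scope classical_set_scope.
Local Open Scope ring_scope.

(** Everything rests on the classical identification of Hom_R(R/J, M) with
    (0 :_M J), by evaluation at the class of 1 ([lmod_iso_ann_Hom]).  For
    J = I^k = (a^k) this makes Hom_R(R/I^k, M) isomorphic to (0 :_M a^k)
    ([ann_ideal_exp]), so that equalities between the submodules (0 :_M a^k)
    and Gamma_a(M) yield isomorphisms between the Hom modules and Gamma_a(M).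

    Conversely, a mere abstract isomorphism is enough to recover those
    equalities, because being killed by a^t is invariant under
    isomorphism ([lmod_iso_kill]) and holds for Hom_R(R/I^t, M)
    ([Hom_quotmod_kill]).  Hence (0 :_M a^k), respectively Gamma_a(M), is
    killed by a^t, which is exactly what being a^t-reduced requires.

    The other implications come from Gamma_a(M) being the union of the
    (0 :_M a^k).  Exactness of 0 -> Gamma_a(M) -> M -> a^t M -> 0 only matters
    at M, where it says that Gamma_a(M) is the kernel (0 :_M a^t) of
    m |-> a^t m. *)

(** * Isomorphic modules *)

Section Isomorphisms.
Context {R : pzRingType}.
Implicit Types U V W : lmodType R.

Lemma linear_bij_lmod_iso U V (f : U -> V) :
  linear f -> bijective f -> lmod_iso U V.
Proof.
move=> lf bf.
pose F : {linear U -> V} := HB.pack f (GRing.isLinear.Build R U V *:%R f lf).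
by exists F.
Qed.

Lemma lmod_iso_sym {U V} : lmod_iso U V -> lmod_iso V U.
Proof.
case=> f [g fK gK]; apply: (@linear_bij_lmod_iso _ _ g); last by exists f.
by move=> c u v; apply: (can_inj fK); rewrite linearP !gK.
Qed.

Lemma lmod_iso_trans {U V W} : lmod_iso U V -> lmod_iso V W -> lmod_iso U W.
Proof. by move=> [f bf] [g bg]; exists (g \o f); apply: bij_comp. Qed.

Lemma lmod_iso_kill {U V} (c : R) :
  lmod_iso U V -> (forall v : V, c *: v = 0) -> forall u : U, c *: u = 0.
Proof.
move=> [f /bij_inj f_inj] c0 u; apply: f_inj.
by rewrite linearZ /= c0 linear0.
Qed.

End Isomorphisms.

(** * Submodules and spans *)

Section Spans.
Context {R : pzRingType}.
Variable V : lmodType R.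

Lemma submod_span_sub (A : set V) (S : submodule V) :
  A `<=` S -> submod_span A `<=` S.
Proof. by move=> AS x; apply; split=> //; apply: carrierP. Qed.

Lemma sub_submod_span (A : set V) : A `<=` submod_span A.
Proof. by move=> x Ax B [_]; apply. Qed.

Lemma submodZ (S : submodule V) (c : R) (x : V) :
  carrier S x -> carrier S (c *: x).
Proof.
by move=> Sx; rewrite -[_ *: _]addr0; apply: submodD => //; apply: submod0.
Qed.

End Spans.

(** * Homomorphisms out of a cyclic module *)

Section HomCyclic.
Context {R : comPzRingType}.
Implicit Types (J : ideal R) (M : lmodType R).

Lemma HomR_linear {U V : lmodType R} (f : HomR U V) : linear (val f).
Proof. exact: set_mem (valP f). Qed.

Lemma HomR0 {U V : lmodType R} (f : HomR U V) : val f 0 = 0.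
Proof. by have := HomR_linear f (-1) 0 0; rewrite !scaleN1r !addNr. Qed.

(** The class of 1 generates R/J, so its image determines a homomorphism. *)
Lemma HomR_quotmodE {J M} (f : HomR (quotmod J) M) (x : R) :
  val f (quotmod_pi J x) = x *: val f (quotmod_pi J 1).
Proof.
have := HomR_linear f x (quotmod_pi J 1) 0; rewrite HomR0 !addr0 => <-.
congr (val f _); rewrite [RHS]quotmod_scaleE; congr quotmod_pi.
by rewrite /GRing.scale /= mulr1.
Qed.

Lemma HomR_quotmod_ext {J M} (f g : HomR (quotmod J) M) :
  val f (quotmod_pi J 1) = val g (quotmod_pi J 1) -> f = g.
Proof.
move=> fg1; apply: val_inj; apply/funext => q.
by have [x ->] := quotmod_reprK q; rewrite HomR_quotmodE fg1 -HomR_quotmodE.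
Qed.

Lemma quotmod_pi_eq0 {J} (x : R) : carrier J x -> quotmod_pi J x = 0.
Proof.
move=> Jx; rewrite -(raddf0 (\pi_(Quotient.quot
  (GRing.ZmodClosed.clone R^o (submod_pred J) _))%qT)).
by apply/quotmod_piE; rewrite subr0; apply: mem_set.
Qed.

Lemma HomR_quotmod_ann {J M} (f : HomR (quotmod J) M) (x : R) :
  carrier J x -> x *: val f (quotmod_pi J 1) = 0.
Proof.
move=> Jx; rewrite -HomR_quotmodE (quotmod_pi_eq0 x Jx).
exact: HomR0.
Qed.

Lemma Hom_quotmod_kill {J M} (x : R) :
  carrier J x -> forall f : HomR (quotmod J) M, x *: f = 0.
Proof. by move=> Jx f; apply: HomR_quotmod_ext; apply: HomR_quotmod_ann. Qed.

(** Evaluation at the class of 1 is inverse to n |-> (x + J |-> x n).  The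
    annihilator (0 :_M J) is given by any N with the right elements, so that
    the result applies directly to submodules introduced in another way, such
    as Gamma_a(M), without transport along an equality of sets. *)
Lemma lmod_iso_ann_Hom J M (N : submodule M) :
  (forall m : M, carrier N m <-> forall x : R, carrier J x -> x *: m = 0) ->
  lmod_iso (submod_type N) (HomR (quotmod J) M).
Proof.
move=> NP.
pose mul (n : submod_type N) (q : quotmod J) : M :=
  (repr (q : Quotient.quot
    (GRing.ZmodClosed.clone R^o (submod_pred J) _)) : R) *: val n.
(* The scalar is well defined modulo J, which kills n. *)
have mulE n (x : R) : mul n (quotmod_pi J x) = x *: val n.
  apply/eqP; rewrite -subr_eq0 -scalerBl; apply/eqP.
  have /NP := set_mem (valP n); apply.
  by apply: set_mem; apply/quotmod_piE; rewrite /quotmod_pi reprK.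
have mul_lin n : linear (mul n).
  move=> c p q.
  have [x ->] := quotmod_reprK p; have [y ->] := quotmod_reprK q.
  rewrite [c *: _]quotmod_scaleE -quotmod_piD !mulE.
  by rewrite scalerDl scalerA.
pose hom n : HomR (quotmod J) M := exist _ (mul n) (mem_set (mul_lin n)).
have ev_in (f : HomR (quotmod J) M) : carrier N (val f (quotmod_pi J 1)).
  by apply/NP => x; apply: HomR_quotmod_ann.
apply: (@linear_bij_lmod_iso _ _ _ hom) => [c u v|].
  apply: HomR_quotmod_ext.
  rewrite -[RHS]/(c *: mul u (quotmod_pi J 1) + mul v (quotmod_pi J 1)).
  by rewrite [LHS]mulE !mulE !scale1r.
exists (fun f => in_submod (ev_in f)) => [n|f].
  by apply: val_inj; rewrite /= mulE scale1r.
by apply: HomR_quotmod_ext; rewrite /= mulE scale1r.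
Qed.

End HomCyclic.

(** * Powers of a principal ideal *)

Section PrincipalPowers.
Context {R : comPzRingType}.
Variable a : R.

Let I : ideal R := submod_span [set (a : R^o)].

(** By induction on k, the multiples of a^(k+1) form a submodule containing
    the generators of I I^k, hence the sums of these generators as well. *)
Lemma principal_expP k (x : R) :
  carrier (ideal_exp I k) x <-> exists r, x = r * a ^+ k.
Proof.
have mult_closed (b : R) :
    submod_closed (in_set [set x : R^o | exists r, x = r * b]).
  apply: submod_closedP => [|c u v [r ->] [s ->]].
    by exists 0; rewrite mul0r.
  by exists (c * r + s); rewrite mulrDl -mulrA.
elim: k x => [|k IHk] x.
  by split=> // _; exists x; rewrite expr0 mulr1.
split.
  apply: (submod_span_sub _ _ (Submodule (mult_closed (a ^+ k.+1)))).
  move=> _ [y Iy [z /IHk[s ->] <-]].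
  have [r ->] : exists r, y = r * a.
    move: Iy; apply: (submod_span_sub _ _ (Submodule (mult_closed a))).
    by move=> _ ->; exists 1; rewrite mul1r.
  by exists (r * s); rewrite exprS mulrACA.
case=> r ->; apply: (submodZ R^o (ideal_exp I k.+1) r (a ^+ k.+1)).
apply: sub_submod_span; exists a; first exact: sub_submod_span.
by exists (a ^+ k); [apply/IHk; exists 1; rewrite mul1r | rewrite exprS].
Qed.

Lemma ann_ideal_exp (M : lmodType R) k (m : M) :
  colon0 a M k m <-> forall x : R, carrier (ideal_exp I k) x -> x *: m = 0.
Proof.
split=> [am0 _ /principal_expP[r ->]|]; first by rewrite -scalerA am0 scaler0.
by apply; apply/principal_expP; exists 1; rewrite mul1r.
Qed.

Lemma colon0_closed (M : lmodType R) k : submod_closed (in_set (colon0 a M k)).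
Proof.
apply: submod_closedP => [|c u v]; rewrite /colon0/= ?scaler0// => u0 v0.
by rewrite scalerDr scalerA mulrC -scalerA u0 v0 scaler0 addr0.
Qed.

Lemma lmod_iso_colon0_Hom (M : lmodType R) k (N : submodule M) :
  carrier N = colon0 a M k ->
  lmod_iso (submod_type N) (HomR (quotmod (ideal_exp I k)) M).
Proof. by move=> NE; apply: lmod_iso_ann_Hom => m; rewrite NE ann_ideal_exp. Qed.

(** Since a^k lies in I^k, it kills Hom_R(R/I^k, M).  This passes to N along
    any isomorphism, whether or not it respects the inclusion of N in M. *)
Lemma sub_colon0_of_iso (M : lmodType R) k (N : submodule M) :
  lmod_iso (submod_type N) (HomR (quotmod (ideal_exp I k)) M) ->
  N `<=` colon0 a M k.
Proof.
move=> iso m Nm.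
have Ik : carrier (ideal_exp I k) (a ^+ k).
  by apply/principal_expP; exists 1; rewrite mul1r.
have killN := lmod_iso_kill _ iso (Hom_quotmod_kill _ Ik).
exact: (congr1 val (killN (in_submod Nm))).
Qed.

Lemma colon0_sub_Gamma (M : lmodType R) k :
  (0 < k)%N -> colon0 a M k `<=` Gamma a M.
Proof. by move=> k0 m; exists k. Qed.

(** An element of Gamma_a(M) may be killed by a power a^k with k < t; raising
    the exponent to t + k brings it in the range where reducedness applies. *)
Lemma reduced_Gamma_sub (M : lmodType R) t :
  (0 < t)%N -> reduced a M t -> Gamma a M `<=` colon0 a M t.
Proof.
move=> t0 red m [k k0 km]; apply: (red m (t + k)%N); rewrite ?addn_gt0 ?t0//.
  exact: leq_addr.
by rewrite exprD -scalerA km scaler0.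
Qed.

End PrincipalPowers.

(** * The equivalences *)

Theorem proposition2p3 (R : comPzRingType) (t : nat) (ht : (0 < t)%N) (a : R)
    (M : lmodType R) :
  let I : ideal R := submod_span [set (a : R^o)] in
  [<-> reduced a M t;
       [set a ^+ t *: m | m in Gamma a M] = [set 0];
       forall k : nat, (0 < k)%N -> (t <= k)%N ->
         colon0 a M k = colon0 a M t;
       forall k : nat, (0 < k)%N -> (t <= k)%N ->
         lmod_iso (HomR (quotmod (ideal_exp I k)) M)
                  (HomR (quotmod (ideal_exp I t)) M);
       lmod_iso (submod_type (Gamma a M))
                (HomR (quotmod (ideal_exp I t)) M);
       short_exact (submod_incl (Gamma a M)) (power_map a M t)].
Proof.
move=> I.
have kerE : power_map a M t @^-1` [set 0] = colon0 a M t.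
  apply/seteqP; split=> m /= am0; first exact: (congr1 val am0).
  exact: val_inj.
have inclE : range (submod_incl (Gamma a M)) = Gamma a M.
  apply/seteqP; split=> [_ [m _ <-]|m Gm]; first exact: set_mem (valP m).
  by exists (in_submod Gm).
tfae.
- move=> red; apply/seteqP; split=> [_ [m Gm <-]|_ ->].
    exact: reduced_Gamma_sub Gm.
  by exists 0; [apply: submod0 | rewrite scaler0].
- move=> aG0 k k0 tk; apply/seteqP; split=> m km.
    rewrite /colon0/= -[_ = 0]/([set 0] _) -aG0.
    by exists m => //; apply: colon0_sub_Gamma km.
  by rewrite /colon0/= -(subnK tk) exprD -scalerA km scaler0.
- move=> colonE k k0 tk.
  pose N := Submodule (colon0_closed a M k).
  apply: (lmod_iso_trans (lmod_iso_sym (lmod_iso_colon0_Hom a M k N erefl))).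
  exact: (lmod_iso_colon0_Hom a M t N (colonE k k0 tk)).
- move=> iso4; apply: lmod_iso_colon0_Hom.
  have red : reduced a M t.
    move=> m k k0 tk; pose N := Submodule (colon0_closed a M k).
    have isoN := lmod_iso_colon0_Hom a M k N erefl.
    exact: (sub_colon0_of_iso a M t N (lmod_iso_trans isoN (iso4 k k0 tk))).
  apply/seteqP; split; first exact: reduced_Gamma_sub.
  exact: colon0_sub_Gamma.
- move=> /sub_colon0_of_iso Gsub; split.
  + apply/seteqP; split=> m /= m0; first exact: val_inj.
    by rewrite m0.
  + rewrite inclE kerE; apply/seteqP; split=> //; exact: colon0_sub_Gamma.
  + apply/seteqP; split=> // -[y Sy] _; have [m _ my] := set_mem Sy.
    by exists m => //; apply: val_inj.
- case=> _ + _; rewrite inclE kerE => GE m k k0 _ km.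
  by rewrite -[_ = 0]/(colon0 a M t m) -GE; apply: colon0_sub_Gamma km.
Qed.
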